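(* Let $X',Y'$ be metric spaces and let $X\subseteq X'$ and $Y\subseteq Y'$ be dense subspaces such that $X'$ is a tight extension of $X$ and $Y'$ is a tight extension of $Y$. Then $X'\times Y'$ is a tight extension of $X\times Y$.
   Context: An extension $X\subseteq Y$ of topological spaces is called tight (and $Y$ is called a tight extension of $X$) if for every cover $X=F^+\cup F^-$ of $X$ by two closed subsets $F^+,F^-$ of $X$ one has $\overline{F^+}^{Y}\cap\overline{F^-}^{Y}=\overline{F^+\cap F^-}^{Y}$, where $\overline{A}^{Y}$ denotes the closure of $A$ in $Y$. The product of two metric spaces carries the metric $d((x,y),(x',y'))=d_X(x,x')+d_Y(y,y')$. *)

(* Defs.v *)
From HB Require Import structures.
From mathcomp Require Import all_boot all_order all_algebra.
From mathcomp Require Import all_classical all_reals all_analysis.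

Set Implicit Arguments.
Unset Strict Implicit.
Unset Printing Implicit Defensive.

Import Order.TTheory GRing.Theory Num.Theory.

Local Open Scope classical_set_scope.
Local Open Scope ring_scope.

(* In [subspace X] the points outside [X] are isolated, so for [F `<=` X],
   closedness in [subspace X] is closedness in the subspace topology of [X];
   the inclusions follow from the covering equation. *)
Definition is_tight_extension (T : topologicalType) (X : set T) : Prop :=
  forall Fp Fm : set T,
    closed (Fp : set (subspace X)) -> closed (Fm : set (subspace X)) ->
    Fp `|` Fm = X ->
    closure Fp `&` closure Fm = closure (Fp `&` Fm).

(* The library's instances on [X * Y] use the maximum of the two distances, so
   the sum metric is put on an alias. *)
Definition sum_prod (X Y : Type) : Type := (X * Y)%type.

HB.instance Definition _ (X Y : choiceType) :=
  Choice.copy (sum_prod X Y) (X * Y)%type.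

Section SumMetric.
Context {R : realType} (X Y : metricType R).

Definition sum_mdist (p q : sum_prod X Y) : R :=
  mdist p.1 q.1 + mdist p.2 q.2.

Let sum_mdistxx p : sum_mdist p p = 0.
Proof. by rewrite /sum_mdist !mdistxx addr0. Qed.

Let sum_mdist_positivity p q : sum_mdist p q = 0 -> p = q.
Proof.
case: p q => [x y] [x' y'] /eqP; rewrite /sum_mdist /= paddr_eq0 ?mdist_ge0//.
by move=> /andP[/eqP/mdist_positivity -> /eqP/mdist_positivity ->].
Qed.

Let sum_mdist_sym p q : sum_mdist p q = sum_mdist q p.
Proof. by congr (_ + _); exact: metric_sym. Qed.

Let sum_mdist_triangle q p r :
  sum_mdist p r <= sum_mdist p q + sum_mdist q r.
Proof. by rewrite /sum_mdist addrACA lerD// metric_triangle. Qed.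

HB.instance Definition _ := @isMetric.Build R (sum_prod X Y) sum_mdist
  sum_mdistxx sum_mdist_positivity sum_mdist_sym sum_mdist_triangle.

End SumMetric.

(* Main.v *)
Require Import Defs.
From mathcomp Require Import all_boot all_order all_algebra.
From mathcomp Require Import all_classical all_reals all_analysis.
From mathcomp Require Import unstable.

(** Tightness is a statement about separation, and locally constant subsets
express it without closures.  Say that [A] is decided at [x] when, near [x],
the set [X] lies inside [A] or inside the complement of [A].  A closed cover
of [X] by two sets whose intersection stays away from a point [x0] is, near
[x0], a partition of [X] into two relatively clopen pieces, that is, a set
decided at all points of [X] near [x0]; and [x0] lies in the closures of both
pieces exactly when that set is undecided at [x0].  So the extension is tight
iff every set decided at the points of [X] near [x0] is decided at [x0]
([tight_extensionP]).

Two-piece partitions control countable ones.  If a function to the natural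
numbers is locally constant on [X] near [x0] and unbounded at [x0], follow a
sequence tending to [x0] along which its values strictly increase, and collect
every other value: the preimage of these values is decided at the nearby
points of [X], yet undecided at [x0].  Hence in a tight metrizable extension
such functions are bounded near [x0] ([locally_constant_bounded]).

For the product, let [A] be decided at the points of [X `*` Y] near
[(x0, y0)].  The crucial step is that if [A] stays away from [(x0, y)] for
every [y] of [Y] near [y0], then it stays away from [(x0, y0)]
([avoidance_extends_snd]).  Otherwise points [p n] of [A] tend to [(x0, y0)];
the vertical sections of [A] through the [p n] are relatively clopen, and they
are locally finite in [Y] near [y0] because [A] avoids the points [(x0, y)].
Thus a bound on the indices of the sections through a point can be chosen to be
locally constant, hence bounded near [y0], which contradicts the fact that the
[n]-th section contains the second coordinate of [p n].

This step is used once in each direction.  When [y] is in [Y], tightness of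
[X] decides the horizontal section at height [y], and the step, with the
factors exchanged, shows that [A] is decided at [(x0, y)]
([decided_at_fiber]).  The verdict at [(x0, y)] is then locally constant in
[y], so tightness of [Y] makes it constant near [y0], and the step carries
this common verdict over to [(x0, y0)] ([nowhere_split_prod]).  Finally, the
sum metric induces the product topology. *)

Set Implicit Arguments.
Unset Strict Implicit.
Unset Printing Implicit Defensive.

Import Order.TTheory GRing.Theory Num.Theory.

Local Open Scope classical_set_scope.

(** * Tightness as a local property *)

Definition decided_at (T : topologicalType) (X A : set T) (x : T) : Prop :=
  (\forall z \near x, X z -> A z) \/ (\forall z \near x, X z -> ~ A z).

Definition nowhere_split (T : topologicalType) (X : set T) : Prop :=
  forall (A : set T) (x0 : T),
    (\forall x \near x0, X x -> decided_at X A x) -> decided_at X A x0.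

Lemma decided_atC (T : topologicalType) (X A : set T) (x : T) :
  decided_at X A x -> decided_at X (~` A) x.
Proof.
by case=> h; [right|left] => //; apply: filterS h => z + Xz => /(_ Xz) Az.
Qed.

Lemma decided_at_iff (T : topologicalType) (X A : set T) (x : T) : X x ->
  decided_at X A x <-> \forall z \near x, X z -> (A z <-> A x).
Proof.
move=> Xx; split=> [[] h|h].
- have Ax := nbhs_singleton h Xx.
  by apply: filterS h => z + Xz => /(_ Xz).
- have Ax := nbhs_singleton h Xx.
  by apply: filterS h => z + Xz => /(_ Xz).
- have [Ax|nAx] := pselect (A x); [left|right];
    by apply: filterS h => z + Xz => /(_ Xz) ->.
Qed.

Lemma near_notin_subspace_closed (T : topologicalType) (X F : set T) (x : T) :
  closed (F : set (subspace X)) -> X x -> ~ F x ->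
  \forall z \near x, X z -> ~ F z.
Proof.
move=> /closed_subspaceP[V cV VF] Xx nFx.
have VFE z : X z -> V z <-> F z.
  move=> Xz; have := congr1 (@^~ z) VF; rewrite /setI /= => e.
  by split=> ?; [have [] : F z /\ X z by rewrite -e|
                 have [] : V z /\ X z by rewrite e].
have oV : open (~` V) by exact: closed_openC.
have : nbhs x (~` V) by apply: open_nbhs_nbhs; split=> // /(VFE _ Xx).
by apply: filterS => z nVz Xz /(VFE _ Xz).
Qed.

(** From left to right, [A] only has to be decided near [x0], whereas
tightness speaks of closed covers of the whole of [X]: both pieces of the cover
are made to contain all points of [X] far from [x0].  That puts these points in
their intersection, which does not change what happens near [x0]. *)
Lemma tight_extensionP (T : topologicalType) (X : set T) :
  is_tight_extension X <-> nowhere_split X.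
Proof.
split=> [tX A x0 Ax0 | sX Fp Fm cFp cFm FpmX].
- pose W := (fun x => X x -> decided_at X A x)°.
  pose P := W `&` (fun z => X z -> A z)°.
  pose Q := W `&` (fun z => X z -> ~ A z)°.
  have Wx0 : nbhs x0 W by exact: nbhs_interior.
  have closedXD (O : set T) : open O -> closed (X `\` O : set (subspace X)).
    move=> oO; apply/closed_subspaceP; exists (~` O); first exact: open_closedC.
    by rewrite setDE setIAC setIid setIC.
  (* [P] and [Q] are open in the ambient space and disjoint on [X]; their
  complements in [X] form the closed cover. *)
  have oP : open P by apply: openI; exact: open_interior.
  have oQ : open Q by apply: openI; exact: open_interior.
  have cover : (X `\` Q) `|` (X `\` P) = X.
    apply/seteqP; split=> z; first by case=> -[].
    move=> Xz; have [Qz|] := pselect (Q z); last by left.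
    right; split=> // -[_ /interior_subset/(_ Xz)].
    by case: Qz => _ /interior_subset/(_ Xz).
  have := tX _ _ (closedXD _ oQ) (closedXD _ oP) cover.
  have nx0 : ~ closure ((X `\` Q) `&` (X `\` P)) x0.
    move=> /(_ _ Wx0)[z [[[Xz nQz] [_ nPz]] Wz]].
    by case: (interior_subset Wz Xz) => h; [apply: nPz|apply: nQz].
  move/(congr1 (@^~ x0)) => e.
  have : ~ (closure (X `\` Q) x0 /\ closure (X `\` P) x0).
    by move: nx0; rewrite -e.
  move/not_andP => [] /existsNP[U /not_implyP[nU /nonemptyPn U0]].
  + right; apply: filterS nU => z Uz Xz; have [[_]|] := pselect (Q z).
      by move=> /interior_subset; exact.
    move=> nQz; exfalso; have : ((X `\` Q) `&` U) z by [].
    by rewrite U0.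
  + left; apply: filterS nU => z Uz Xz; have [[_]|] := pselect (P z).
      by move=> /interior_subset; exact.
    move=> nPz; exfalso; have : ((X `\` P) `&` U) z by [].
    by rewrite U0.
- apply/seteqP; split=> [x0 [xp xm]|x0 x0pm]; last first.
    by split; apply: closureS x0pm; [exact: subIsetl|exact: subIsetr].
  apply: contrapT => /existsNP[U /not_implyP[nU /nonemptyPn U0]].
  have pm z : U z -> Fp z -> ~ Fm z.
    by move=> Uz pz mz; have : (Fp `&` Fm `&` U) z by []; rewrite U0.
  have XF z : X z -> Fp z \/ Fm z by rewrite -FpmX.
  have FmX z : Fm z -> X z by move=> ?; rewrite -FpmX; right.
  have FpX z : Fp z -> X z by move=> ?; rewrite -FpmX; left.
  have [|h|h] := sX Fp x0.
  + apply: filterS nU => z Uz Xz; have [Fpz|nFpz] := pselect (Fp z).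
      left; have := near_notin_subspace_closed cFm Xz (pm _ Uz Fpz).
      by apply: filterS => t + Xt => /(_ Xt); case: (XF _ Xt).
    by right; exact: near_notin_subspace_closed.
  + have [z [mz [Uz /(_ (FmX _ mz)) pz]]] := xm _ (filterI nU h).
    exact: pm Uz pz mz.
  + by have [z [pz [_ /(_ (FpX _ pz))]]] := xp _ (filterI nU h).
Qed.

(** * Boundedness of locally constant functions *)

(** The diagonal form, with a property that varies with the index, allows
properties that become stronger along the sequence. *)
Lemma cvg_seq_of_frequently (R : realType) (T : pseudoMetricType R) (x0 : T)
    (P : nat -> set T) :
  (forall n, ~ \forall z \near x0, ~ P n z) ->
  exists2 u : nat -> T, u @ \oo --> x0 & forall n, P n (u n).
Proof.
move=> freq.
have /choice[u uP] n : exists z, ball x0 (n.+1%:R^-1)%R z /\ P n z.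
  apply: contrapT => /forallNP h; apply: (freq n).
  have : nbhs x0 (ball x0 (n.+1%:R^-1)%R).
    by apply: nbhsx_ballx; rewrite invr_gt0.
  by apply: filterS => z zb Pz; apply: (h z).
exists u => [|n]; last by case: (uP n).
apply/cvg_ballP => e e0; near=> n; apply: le_ball (uP n).1; apply: ltW.
by near: n; exact: (near_infty_natSinv_lt (PosNum e0)).
Unshelve. all: by end_near. Qed.

Lemma locally_constant_bounded (R : realType) (T : pseudoMetricType R)
    (X : set T) (x0 : T) (c : T -> nat) : nowhere_split X ->
  (\forall x \near x0, X x -> \forall z \near x, X z -> c z = c x) ->
  exists n, \forall z \near x0, X z -> (c z < n)%N.
Proof.
move=> sX cloc; apply: contrapT => /forallNP unb.
have [|y ycvg yP] := @cvg_seq_of_frequently R T x0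
    (fun n z => X z /\ (n <= c z)%N).
  move=> n h; apply: (unb n); apply: filterS h => z h Xz.
  by rewrite ltnNge; apply/negP => ?; apply: h.
(* Since [n <= c (y n)], jumping from index [n] to [(c (y n)).+1] makes the
values of [c] strictly increase. *)
pose m k := iter k (fun n => (c (y n)).+1) 0%N.
have cm_mono : {homo (fun k => c (y (m k))) : j k / (j < k)%N >-> (j < k)%N}.
  by apply: homo_ltn => [? ? ?|k]; [exact: ltn_trans|exact: (yP (m k.+1)).2].
have cm_inj : injective (fun k => c (y (m k))).
  by apply: incn_inj; exact: leq_mono.
have mge k : (k <= m k)%N.
  by elim: k => // k IH; apply: leq_ltn_trans IH _; exact: (yP (m k)).2.
have mcvg (U : set T) :
    nbhs x0 U -> exists N, forall k, (N <= k)%N -> U (y (m k)).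
  move=> /ycvg[N _ h]; exists N => k Nk; apply: h => /=.
  exact: leq_trans Nk (mge k).
(* Even indices give points of the set arbitrarily close to [x0], and odd
indices give points of its complement. *)
have [|h|h] := sX (fun z => exists k, c z = c (y (m k.*2))) x0.
- apply: filterS cloc => x + Xx => /(_ Xx) cx.
  by apply/decided_at_iff => //; apply: filterS cx => z + Xz => /(_ Xz) ->.
- have [N /(_ N.*2.+1)] := mcvg _ h.
  case=> [||j /cm_inj]; last by move/(congr1 odd); rewrite /= !odd_double.
    by rewrite -addnn -addnS leq_addr.
  exact: (yP _).1.
- have [N /(_ N.*2)] := mcvg _ h.
  case; first by rewrite -addnn leq_addr.
    exact: (yP _).1.
  by exists N.
Qed.

(** * Sections of subsets of a product *)

Section Sections.
Context (T T' : topologicalType).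
Implicit Types (x : T) (y : T') (X : set T) (Y : set T').

Lemma near_section x y (P : set (T * T')) :
  (\forall p \near (x, y), P p) -> \forall z \near y, P (x, z).
Proof.
move=> [[U V] /= [nU nV] UV]; apply: filterS nV => z Vz.
by apply: UV; split=> //=; exact: nbhs_singleton.
Qed.

Lemma near_near_section x y (P : set (T * T')) :
  (\forall p \near (x, y), P p) ->
  \forall z \near y, \forall p \near (x, z), P p.
Proof. by move=> /near_join/near_section. Qed.

Lemma near_swap x y (P : set (T * T')) :
  (\forall p \near (x, y), P p) <-> \forall p \near (y, x), P (swap p).
Proof.
split=> h; first exact: (@swap_continuous _ _ (y, x) _ h).
have := @swap_continuous _ _ (x, y) _ h.
by rewrite /nbhs/=; apply: filterS => -[].
Qed.

Lemma decided_at_section X Y (A : set (T * T')) x y : X x ->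
  decided_at (X `*` Y) A (x, y) -> decided_at Y (fun z => A (x, z)) y.
Proof.
by move=> Xx [] /near_section h; [left|right];
  apply: filterS h => z h Yz; exact: h.
Qed.

Lemma decided_at_swap X Y (A : set (T * T')) x y :
  decided_at (X `*` Y) A (x, y) <->
  decided_at (Y `*` X) (A \o swap) (y, x).
Proof.
split=> -[] h; [left|right|left|right].
- by move/near_swap : h; apply: filterS => -[a b] /= h [? ?]; exact: h.
- by move/near_swap : h; apply: filterS => -[a b] /= h [? ?]; exact: h.
- by apply/near_swap; apply: filterS h => -[a b] /= h [? ?]; exact: h.
- by apply/near_swap; apply: filterS h => -[a b] /= h [? ?]; exact: h.
Qed.

End Sections.

(** * Products *)

Section Product.
Context {R : realType}.

(** A sequence of points of [A] tending to [(x0, y0)] would produce infinitely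
many vertical sections of [A] accumulating at [y0], although they are
relatively clopen and locally finite in [Y] near [y0]; an index bound for this
family is then an unbounded locally constant function. *)
Lemma avoidance_extends_snd (X' Y' : pseudoMetricType R) (X : set X')
    (Y : set Y') (A : set (X' * Y')) (x0 : X') (y0 : Y') : nowhere_split Y ->
  (\forall p \near (x0, y0), (X `*` Y) p -> decided_at (X `*` Y) A p) ->
  (\forall y \near y0, Y y ->
     \forall p \near (x0, y), (X `*` Y) p -> ~ A p) ->
  \forall p \near (x0, y0), (X `*` Y) p -> ~ A p.
Proof.
move=> sY [[U V] /= [nU nV] UVdec] Ay; apply: contrapT => nA.
have [|p pcvg pP] := @cvg_seq_of_frequently R (X' * Y')%type (x0, y0)
    (fun=> [set q | [/\ (X `*` Y) q, A q & U q.1]]).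
  move=> _ h; apply: nA.
  have nU2 : \forall q \near (x0, y0), U q.1 by exact: (cvg_fst nU).
  by apply: filterS2 h nU2 => q h Uq XYq Aq; apply: h.
have p1cvg : (fun n => (p n).1) @ \oo --> x0.
  by apply: cvg_comp pcvg _; exact: cvg_fst.
have p2cvg : (fun n => (p n).2) @ \oo --> y0.
  by apply: cvg_comp pcvg _; exact: cvg_snd.
pose E z n := A ((p n).1, z).
have Eloc : \forall y \near y0, Y y ->
    exists N, \forall z \near y, Y z ->
      E z = E y /\ forall n, (N <= n)%N -> ~ E z n.
  apply: filterS2 nV Ay => y Vy Ay Yy.
  have [[U1 V1] /= [nU1 nV1] UV1] := Ay Yy.
  have V1y := nbhs_singleton nV1.
  have [N _ NU1] := p1cvg _ nU1; exists N.
  have tail z : Y z -> V1 z -> forall n, (N <= n)%N -> ~ E z n.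
    move=> Yz Vz n Nn; have [[Xp _] _ _] := pP n.
    by apply: (UV1 ((p n).1, z)); split=> //=; exact: NU1.
  (* Only the first [N] sections matter near [y], and each of them is
  decided at [y]. *)
  have init : \forall z \near y, forall i : 'I_N, Y z -> (E z i <-> E y i).
    apply: filter_forall => i; have [[Xp Yp] _ Up] := pP i.
    apply/(decided_at_iff _ Yy).
    apply: (decided_at_section Xp); exact: UVdec.
  apply: filterS2 nV1 init => z V1z init Yz; split; last exact: tail.
  apply/funext => n; apply/propext; have [Nn|nN] := leqP N n.
    by split=> [/(tail _ Yz V1z _ Nn)|/(tail _ Yy V1y _ Nn)].
  exact: (init (Ordinal nN)).
(* [c z] is a function of the sequence [E z] alone, so it is locally constant
wherever [E] is. *)
pose c z := xget 0%N [set N | forall n, (N <= n)%N -> ~ E z n].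
have [|k ck] := @locally_constant_bounded R Y' Y y0 c sY.
  apply: filterS Eloc => y + Yy => /(_ Yy)[N h].
  by apply: filterS h => z + Yz => /(_ Yz)[Ez _]; rewrite /c Ez.
have : \forall y \near y0, Y y -> forall n, (k <= n)%N -> ~ E y n.
  apply: filterS2 ck Eloc => y + + Yy => /(_ Yy) cy /(_ Yy)[N /nbhs_singleton].
  move=> /(_ Yy)[_ EN] n kn.
  have : [set N | forall n, (N <= n)%N -> ~ E y n] (c y) by exact: xgetI EN.
  by apply; exact: leq_trans (ltnW cy) kn.
move=> /p2cvg[M _ hM].
have [[_ Yp] Ap _] := pP (maxn M k).
apply: (hM (maxn M k) _ Yp (maxn M k)); rewrite /= ?leq_maxl ?leq_maxr //.
by rewrite /E -surjective_pairing.
Qed.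

Lemma avoidance_extends_fst (X' Y' : pseudoMetricType R) (X : set X')
    (Y : set Y') (A : set (X' * Y')) (x0 : X') (y0 : Y') : nowhere_split X ->
  (\forall p \near (x0, y0), (X `*` Y) p -> decided_at (X `*` Y) A p) ->
  (\forall x \near x0, X x ->
     \forall p \near (x, y0), (X `*` Y) p -> ~ A p) ->
  \forall p \near (x0, y0), (X `*` Y) p -> ~ A p.
Proof.
move=> sX /near_swap dec Ax; apply/near_swap.
have := @avoidance_extends_snd Y' X' Y X (A \o swap) y0 x0 sX.
case=> [||[U V] nUV UV].
- apply: filterS dec => -[y x] h [Yy Xx].
  by apply: (@decided_at_swap _ _ X Y A x y).1; exact: h.
- apply: filterS Ax => x + Xx => /(_ Xx)/near_swap.
  by apply: filterS => -[y x'] /= h [? ?]; exact: h.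
by exists (U, V) => // -[y x] /UV/= h [? ?]; exact: h.
Qed.

(** Along the line at height [y], tightness of [X] gives a single verdict near
[x0]; each point of [X `*` Y] on this line spreads it to a neighbourhood, so
avoidance extends from these points to [(x0, y)]. *)
Lemma decided_at_fiber (X' Y' : pseudoMetricType R) (X : set X')
    (Y : set Y') (A : set (X' * Y')) (x0 : X') (y : Y') : nowhere_split X ->
  Y y ->
  (\forall p \near (x0, y), (X `*` Y) p -> decided_at (X `*` Y) A p) ->
  decided_at (X `*` Y) A (x0, y).
Proof.
move=> sX Yy dec.
have : \forall x \near x0, X x -> decided_at (X `*` Y) A (x, y).
  by move/near_swap/near_section : dec; apply: filterS => x + Xx; exact.
move=> decx.
(* Passing to the complement of [A] leaves the negative verdict. *)
wlog h : A dec decx / \forall x \near x0, X x -> ~ A (x, y).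
  move=> H; have [|h|h] := sX (fun x => A (x, y)) x0; last exact: H.
  + apply: filterS decx => x + Xx => /(_ Xx)/decided_at_swap.
    exact: decided_at_section.
  + rewrite -(setCK A); apply: decided_atC; apply: H.
    * by apply: filterS dec => p + XYp => /(_ XYp); exact: decided_atC.
    * by apply: filterS decx => x + Xx => /(_ Xx); exact: decided_atC.
    * by apply: filterS h => x + Xx nAx => /(_ Xx); exact: nAx.
right; apply: avoidance_extends_fst => //.
apply: filterS2 h decx => x + + Xx => /(_ Xx) nA /(_ Xx)[]// h.
by have := nbhs_singleton h (conj Xx Yy).
Qed.

(** The set [B] of the heights [y] with a positive verdict at [(x0, y)] is
itself decided at the points of [Y] near [y0].  This needs points of [X] close
to [x0]: they exclude that both verdicts hold at a point [(x0, z)] with [z] in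
[Y]. *)
Lemma nowhere_split_prod (X' Y' : pseudoMetricType R) (X : set X')
    (Y : set Y') : nowhere_split X -> nowhere_split Y ->
  nowhere_split (X `*` Y : set (X' * Y')%type).
Proof.
move=> sX sY A [x0 y0] dec.
have [noX|freqX] := pselect (\forall x \near x0, ~ X x).
  left; have : \forall p \near (x0, y0), ~ X p.1 by exact: (cvg_fst noX).
  by apply: filterS => p ? [].
pose B (y : Y') := \forall p \near (x0, y), (X `*` Y) p -> A p.
have decy : \forall y \near y0, Y y -> decided_at (X `*` Y) A (x0, y).
  by apply: filterS (near_near_section dec) => y + Yy; exact: decided_at_fiber.
have [|h|h] := sY B y0.
- apply: filterS decy => y + Yy => /(_ Yy)[] /near_near_section h; [left|right].
    by apply: filterS h.
  apply: filterS h => z nA Yz Az; apply: freqX.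
  have : \forall p \near (x0, z), (X `*` Y) p -> False.
    by apply: filterS2 nA Az => p nA Ap XYp; exact: nA (Ap XYp).
  by move=> /near_swap/near_section; apply: filterS => x nXY Xx; exact: nXY.
- left; have : \forall p \near (x0, y0), (X `*` Y) p -> ~ (~` A) p.
    apply: avoidance_extends_snd => //.
    + by apply: filterS dec => p + XYp => /(_ XYp); exact: decided_atC.
    + apply: filterS h => y + Yy => /(_ Yy).
      by apply: filterS => p + XYp => /(_ XYp) Ap nAp; exact: nAp.
  by apply: filterS => p + XYp => /(_ XYp)/contrapT.
- right; apply: avoidance_extends_snd => //.
  by apply: filterS2 h decy => y + + Yy => /(_ Yy) nB /(_ Yy)[].
Qed.

(** The ball for the sum metric contains the product of the balls of half the
radius, and is contained in the product of the balls of the same radius. *)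
Lemma nbhs_sum_prod (X Y : metricType R) (p : X * Y) :
  nbhs (p : sum_prod X Y) = nbhs p.
Proof.
apply/seteqP; split=> U; rewrite -!nbhs_ballE => -[e /= e0 eU].
- exists (e / 2)%R; first by rewrite /= divr_gt0.
  move=> q [q1 q2]; apply: eU; rewrite ballEmdist /=.
  rewrite (splitr e) /mdist /= /sum_mdist ltrD//.
    by move: q1; rewrite ballEmdist.
  by move: q2; rewrite ballEmdist.
- exists e => // q; rewrite ballEmdist /mdist /= /sum_mdist => pq.
  apply: eU; split; rewrite ballEmdist /=; apply: le_lt_trans pq.
    by rewrite lerDl mdist_ge0.
  by rewrite lerDr mdist_ge0.
Qed.

End Product.

Theorem theorem5p1 (R : realType) (X' Y' : metricType R)
    (X : set X') (Y : set Y')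
    (denseX : dense X) (denseY : dense Y)
    (tightX : is_tight_extension X) (tightY : is_tight_extension Y) :
  is_tight_extension (X `*` Y : set (sum_prod X' Y')).
Proof.
apply/tight_extensionP.
have := nowhere_split_prod ((tight_extensionP X).1 tightX)
  ((tight_extensionP Y).1 tightY).
move=> sXY A p dec.
have decE q : decided_at (X `*` Y : set (sum_prod X' Y')) A q <->
    decided_at (X `*` Y : set (X' * Y')%type) A q.
  by rewrite /decided_at /prop_near1 nbhs_sum_prod.
apply/decE/sXY; move: dec; rewrite {1}/prop_near1 nbhs_sum_prod.
by apply: filterS => q h XYq; apply/decE; exact: h.
Qed.
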